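(* If $T$ is a connected $\mathbb{Z}^d$-tile and if $\#(T\cap(T+s))\neq 1$ for all $s\in\mathbb{Z}^d$, then either $T$ has a cut point or each irreducible cut set of $T$ is a perfect set.
   Context: A $\mathbb{Z}^d$-tile (integral self-affine $\mathbb{Z}^d$-tile with standard digit set) $T=T(A,\mathcal{D})\subset\mathbb{R}^d$ is given by a $d\times d$ integer matrix $A$ all of whose eigenvalues are greater than $1$ in modulus and a complete set $\mathcal{D}\subset\mathbb{Z}^d$ of coset representatives of $\mathbb{Z}^d/A\mathbb{Z}^d$ (so $|\mathcal{D}|=|\det A|$); $T$ is the unique nonempty compact set with $AT=T+\mathcal{D}=\bigcup_{e\in\mathcal{D}}(T+e)$. It is assumed that $T$ has nonempty interior and that $T+\mathbb{Z}^d$ is a tiling of $\mathbb{R}^d$: $\mathbb{R}^d=T+\mathbb{Z}^d$ and $\mathrm{int}(T+d_1)\cap(T+d_2)=\emptyset$ for all $d_1\ne d_2$ in $\mathbb{Z}^d$. A cut set of a connected set $Y$ is a subset $X\subset Y$ such that $Y\setminus X$ is disconnected; a cut point of $Y$ is a point $x\in Y$ such that $\{x\}$ is a cut set of $Y$. A cut set $X$ of a connected set $Y$ is irreducible if $Y\setminus X_0$ is connected for every proper subset $X_0$ of $X$ which is closed in $Y$. A set $X$ is perfect if it equals its derived set $X'$ (the set of its limit points). ''Either ... or'' is understood inclusively (at least one alternative holds). *)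

(* Defs.v *)
From HB Require Import structures.
From mathcomp Require Import all_boot all_order all_algebra.
From mathcomp Require Import complex.
From mathcomp Require Import all_classical all_reals all_analysis.

Set Implicit Arguments.
Unset Strict Implicit.
Unset Printing Implicit Defensive.

Import Order.TTheory GRing.Theory Num.Theory.
Import numFieldNormedType.Exports.

Local Open Scope classical_set_scope.
Local Open Scope ring_scope.

(* Vectors of R^d and Z^d are column vectors, so that A acts by A *m x. *)
Definition zvec (R : realType) (d : nat) (s : 'cV[int]_d) : 'cV[R]_d :=
  map_mx intr s.

Definition translate (R : realType) (d : nat) (T : set 'cV[R]_d)
    (s : 'cV[int]_d) : set 'cV[R]_d :=
  [set x + zvec R s | x in T].

(* Eigenvalues are taken over the complex numbers R[i]; the comparison is in
   the partial order of R[i], in which 1 and the modulus `|a| are both real. *)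
Definition expanding (R : realType) (d : nat) (A : 'M[int]_d) : Prop :=
  forall a : R[i], eigenvalue (map_mx intr A : 'M[R[i]]_d) a -> 1 < `|a|.

(* Each class of Z^d / A Z^d meets D in exactly one element. If A is nonsingular,
   it follows that D is finite, of cardinality |det A|. *)
Definition coset_representatives (d : nat) (A : 'M[int]_d)
    (D : set 'cV[int]_d) : Prop :=
  forall z : 'cV[int]_d,
    exists! e, D e /\ exists w : 'cV[int]_d, z - e = A *m w.

(* For expanding A and finite D, the fields tile_nonempty, tile_compact and
   tile_equation determine T uniquely. *)
Record Zd_tile (R : realType) (d : nat) (A : 'M[int]_d)
    (D : set 'cV[int]_d) (T : set 'cV[R]_d) : Prop := {
  tile_expanding : expanding R A ;
  tile_digits : coset_representatives A D ;
  tile_nonempty : T !=set0 ;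
  tile_compact : compact T ;
  tile_equation :
    [set (map_mx intr A : 'M[R]_d) *m x | x in T] =
    \bigcup_(e in D) translate T e ;
  tile_interior : interior T !=set0 ;
  tile_cover : \bigcup_(s in [set: 'cV[int]_d]) translate T s = setT ;
  tile_disjoint : forall s1 s2 : 'cV[int]_d, s1 <> s2 ->
    interior (translate T s1) `&` translate T s2 = set0
}.

Definition cut_set (X : topologicalType) (Y C : set X) : Prop :=
  C `<=` Y /\ ~ connected (Y `\` C).

Definition cut_point (X : topologicalType) (Y : set X) (x : X) : Prop :=
  Y x /\ cut_set Y [set x].

(* The last hypothesis says that C0 is closed in the subspace Y. *)
Definition irreducible_cut_set (X : topologicalType) (Y C : set X) : Prop :=
  cut_set Y C /\
  forall C0 : set X, C0 `<` C -> (exists2 F, closed F & C0 = Y `&` F) ->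
    connected (Y `\` C0).

(* Main.v *)
Require Import Defs.
From mathcomp Require Import all_boot all_order all_algebra.
From mathcomp Require Import complex zify.
From mathcomp Require Import all_classical all_reals all_analysis.

(* Let X be an irreducible cut set of T. Then X is closed, and T \ X splits into
   two relatively open parts, both accumulating at every point of X. Suppose that
   x is isolated in X and that T has no cut point. The set T is a finite union of
   copies A^-n (T + s), of diameter tending to 0 as n grows. A small copy containing
   x stays connected when x is removed, hence apart from x it lies in one of the
   two parts, and both parts occur. Two copies in different parts meet exactly in
   x, so some intersection of T with T + s is a single point. *)

Set Implicit Arguments.
Unset Strict Implicit.
Unset Printing Implicit Defensive.

Import Order.TTheory GRing.Theory Num.Theory.
Import numFieldNormedType.Exports.
Import ComplexField.Normc.
Local Open Scope classical_set_scope.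
Local Open Scope ring_scope.

(** * Powers of complex matrices with eigenvalues in the open unit disc *)

Lemma normc_ge0 (R : rcfType) (z : R[i]) : 0 <= normc z.
Proof. by case: z => a b; rewrite sqrtr_ge0. Qed.

Lemma normr_normc (R : rcfType) (z : R[i]) : `|z| = (normc z)%:C%C.
Proof. by case: z => a b; rewrite normc_def. Qed.

Lemma normc_real (R : rcfType) (x : R) : normc x%:C%C = `|x|.
Proof. by rewrite /normc/= expr0n/= addr0 sqrtr_sqr. Qed.

(** Since [e / 2] is the fixed point of [t |-> q * t + e / 2 * (1 - q)], each excess of [r] over
    [e / 2] is at most [q] times the previous one as soon as [y n <= e / 2 * (1 - q)]. *)
Lemma cvg0_contractive_recurrence (R : realType) (q : R) (r y : R^nat) :
  0 <= q < 1 -> (forall n, 0 <= r n) -> (forall n, r n.+1 <= q * r n + y n) ->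
  y @ \oo --> 0 -> r @ \oo --> 0.
Proof.
move=> /andP[q0 q1] r0 ry y0.
apply/cvgrPdist_le => e e0.
have e20 : 0 < e / 2 by rewrite divr_gt0.
have [N _ yN] : \forall n \near \oo, y n <= e / 2 * (1 - q).
  have /cvgr0Pnorm_le/(_ (e / 2 * (1 - q))) := y0.
  rewrite mulr_gt0 ?subr_gt0// => /(_ erefl); apply: filterS => n.
  by apply: le_trans; rewrite ler_norm.
have step k : r (k + N)%N - e / 2 <= q ^+ k * r N.
  elim: k => [|k IH]; first by rewrite mul1r gerBl ltW.
  rewrite addSn lerBlDr (le_trans (ry _))//.
  rewrite (@le_trans _ _ (q * (q ^+ k * r N + e / 2) + e / 2 * (1 - q)))//.
    by rewrite lerD ?ler_wpM2l -?lerBlDr ?yN//= leq_addl.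
  by rewrite exprS mulrDr mulrBr mulr1 mulrA (mulrC (e / 2)) -addrA subrKC.
have : (fun k => q ^+ k * r N) @ \oo --> 0 * r N.
  by apply: cvgMr_tmp; apply: cvg_expr; rewrite ger0_norm.
rewrite mul0r => /cvgr0Pnorm_le/(_ _ e20)[K _ qK].
exists (K + N)%N => // n /= Kn.
rewrite sub0r normrN ger0_norm// -[n](subnK (leq_trans (leq_addl K N) Kn)).
rewrite [e]splitr -lerBlDr (le_trans (step _))// (le_trans (ler_norm _))//.
by apply: qK; rewrite /= leq_subRL ?(leq_trans (leq_addl K N) Kn)// addnC.
Qed.

(* One factor is removed at a time: if Q is the product of the remaining ones and
   u_n is an entry of B^n Q, the hypothesis says that u_(n+1) - z u_n tends to 0.
   By Cayley-Hamilton it holds when rs lists the eigenvalues of B. *)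
Lemma cvg0_expmx_prod (R : realType) d (B : 'M[R[i]]_d.+1) (rs : seq R[i]) :
  (forall z, z \in rs -> normc z < 1) ->
  (forall i j, normc ((B ^+ n * \prod_(z <- rs) (B - z%:M)) i j) @[n --> \oo]
     --> (0 : R)) ->
  forall i j, normc ((B ^+ n) i j) @[n --> \oo] --> (0 : R).
Proof.
elim: rs => [|z rs IH] rs1 H i j.
  by have := H i j; under eq_cvg do rewrite big_nil mulr1.
apply: IH => [w wrs|{}i {}j]; first by rewrite rs1// inE wrs orbT.
pose P := \prod_(w <- rs) (B - w%:M).
apply: (@cvg0_contractive_recurrence _ (normc z) _
  (fun n => normc ((B ^+ n * \prod_(w <- z :: rs) (B - w%:M)) i j))) => //.
- by rewrite normc_ge0 rs1// mem_head.
- by move=> n; exact: normc_ge0.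
move=> n; rewrite -normcM (le_trans _ (le_normcD _ _))//.
have -> // : (B ^+ n.+1 * P) i j = z * (B ^+ n * P) i j +
    (B ^+ n * \prod_(w <- z :: rs) (B - w%:M)) i j.
rewrite big_cons -/P exprSr mulrA mulrBr mulrBl.
rewrite -(mulrA _ z%:M) -[z%:M * P]/(z%:M *m P) mul_scalar_mx.
by rewrite -[B ^+ n * (z *: P)]scalemxAr !mxE subrKC.
Qed.

(** The characteristic polynomial splits over [R[i]]; with its roots as [rs] the full product is 0,
    so the starting hypothesis on the products is trivial. *)
Lemma cvg0_expmx (R : realType) d (B : 'M[R[i]]_d) :
  (forall z, eigenvalue B z -> normc z < 1) ->
  forall i j, normc ((B ^+ n) i j) @[n --> \oo] --> (0 : R).
Proof.
case: d B => [|d] B eB; first by case.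
have [rs cB] := closed_field_poly_normal (char_poly B).
move: cB; rewrite (eqP (char_poly_monic B)) scale1r => cB.
apply: (@cvg0_expmx_prod _ _ _ rs) => [z zrs|i j].
  by apply: eB; rewrite eigenvalue_root_char cB root_prod_XsubC.
have -> : \prod_(z <- rs) (B - z%:M) = 0.
  rewrite -(Cayley_Hamilton B) cB rmorph_prod/=.
  by apply: eq_bigr => z _; rewrite rmorphB/= horner_mx_X horner_mx_C.
under eq_cvg do rewrite mulr0 mxE normc0.
exact: cvg_cst.
Qed.

(** * Expanding integer matrices and their inverses *)

(** A nonzero kernel would make 0 an eigenvalue. *)
Lemma expanding_unitmx (R : realType) d (A : 'M[int]_d) :
  expanding R A -> (map_mx intr A : 'M[R[i]]_d) \in unitmx.
Proof.
move=> eA; rewrite -row_free_unit -kermx_eq0; apply: contraT => kA.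
have := eA 0; rewrite normr0 ltr10 => /implyP.
by rewrite /eigenvalue /eigenspace raddf0 subr0 kA.
Qed.

Lemma map_mx_real_complex (R : realType) d (A : 'M[int]_d) :
  map_mx (real_complex R) (map_mx intr A : 'M[R]_d) = map_mx intr A.
Proof. by rewrite -map_mx_comp; apply: eq_map_mx => z /=; rewrite rmorph_int. Qed.

Lemma expanding_unitmx_real (R : realType) d (A : 'M[int]_d) :
  expanding R A -> (map_mx intr A : 'M[R]_d) \in unitmx.
Proof. by move/expanding_unitmx; rewrite -map_mx_real_complex map_unitmx. Qed.

(** The eigenvalues of the inverse are inverses of eigenvalues of [A], hence of modulus below 1. The
    limit is obtained over [R[i]] and carried back to [R]. *)
Lemma expanding_cvg0 (R : realType) d (A : 'M[int]_d) : expanding R A ->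
  forall i j, (invmx (map_mx intr A : 'M[R]_d) ^+ n) i j @[n --> \oo] --> (0 : R).
Proof.
move=> eA i j; have uA := expanding_unitmx eA.
have : forall z, eigenvalue (invmx (map_mx intr A : 'M[R[i]]_d)) z -> normc z < 1.
  move=> z /eigenvalueP[v vz v0].
  have vE : v = z *: (v *m map_mx intr A) by rewrite scalemxAl -vz mulmxKV.
  have z0 : z != 0.
    by apply: contra_neq v0 => z0; rewrite vE z0 scale0r.
  have /eA : eigenvalue (map_mx intr A : 'M[R[i]]_d) z^-1.
    apply/eigenvalueP; exists v => //.
    by rewrite {2}vE scalerA mulVf// scale1r.
  rewrite normfV invf_gt1 ?normr_gt0//.
  by rewrite normr_normc -[1]/(1%:C%C) ltcR.
move=> /cvg0_expmx/(_ i j) H; rewrite -map_mx_real_complex -map_invmx in H.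
have normE n : normc ((map_mx (real_complex R) (invmx (map_mx intr A)) ^+ n) i j)
   = `|(invmx (map_mx intr A) ^+ n) i j|.
  by rewrite -rmorphXn mxE normc_real.
move: H; under eq_cvg do rewrite normE.
move=> /cvgr0Pnorm_le H; apply/cvgr0Pnorm_le => e e0.
by move: (H e e0); apply: filterS => n; rewrite normr_id.
Qed.

(** * Separation by open sets and irreducible cut sets *)

(** The part of [Y] in [U] is open in [Y], and closed in [Y] because it is the part outside [V]. *)
Lemma connected_open_cover (X : topologicalType) (Y U V : set X) :
  connected Y -> open U -> open V -> Y `<=` U `|` V ->
  Y `&` (U `&` V) = set0 -> Y `&` U !=set0 -> Y `<=` U.
Proof.
move=> cY oU oV YUV UV0 YU0; apply/setIidPl; apply: cY => //.
  by exists U.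
exists (~` V); first exact: open_closedC.
apply/seteqP; split=> y [Yy] => [Uy|nVy]; split=> //.
  by move=> Vy; rewrite -[False]/(set0 y) -UV0.
by case: (YUV _ Yy).
Qed.

(** Each point has a ball missing the other set. Halve the radii: if two halved balls met, the
    larger of the full balls would contain the other centre. *)
Lemma separated_open_disjoint (R : realFieldType) (X : pseudoMetricType R)
    (E F : set X) : separated E F ->
  exists U V, [/\ open U, open V, E `<=` U, F `<=` V & U `&` V = set0].
Proof.
have radius (G H : set X) : G `&` closure H = set0 ->
    exists r : X -> R, forall x, G x -> 0 < r x /\ forall y, H y -> ~ ball x (r x) y.
  move=> GH0; have /choice[r rP] : forall x, exists r : R,
      G x -> 0 < r /\ forall y, H y -> ~ ball x r y.
    move=> x; have [Gx|nGx] := pselect (G x); last by exists 0.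
    have : ~ closure H x by move=> Hx; rewrite -[False]/(set0 x) -GH0.
    move=> /existsNP[W /not_implyP[/nbhs_ballP[r r0 rW] HW]].
    exists r => _; split=> // y Hy xy.
    by apply: HW; exists y; split=> //; exact: rW.
  by exists r.
rewrite /separated setIC => -[/radius[s sP] /radius[r rP]].
(* Balls of a [pseudoMetricType] need not be open, hence the interiors. *)
exists (\bigcup_(x in E) (ball x (r x / 2))^°),
  (\bigcup_(x in F) (ball x (s x / 2))^°); split.
- by apply: bigcup_open => x _; exact: open_interior.
- by apply: bigcup_open => x _; exact: open_interior.
- by move=> x Ex; exists x => //; apply: nbhsx_ballx; rewrite divr_gt0// (rP x Ex).1.
- by move=> x Fx; exists x => //; apply: nbhsx_ballx; rewrite divr_gt0// (sP x Fx).1.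
rewrite -subset0 => z [[x Ex /interior_subset xz] [y Fy /interior_subset yz]].
have [_ rx] := rP _ Ex; have [_ sy] := sP _ Fy.
have [rs|sr] := leP (r x) (s y).
  apply: (sy _ Ex); apply: (@ball_splitr _ _ z); apply: ball_sym => //.
  by apply: le_ball xz; rewrite ler_pM2r// invr_gt0.
apply: (rx _ Fy); apply: (@ball_splitr _ _ z); apply: ball_sym => //.
by apply: le_ball yz; rewrite ler_pM2r ?invr_gt0// ltW.
Qed.

(** Enclose the two separated parts of the complement in disjoint open sets [U] and [V]. What they
    leave of [Y] is closed in [Y], lies in [C] and still cuts [Y], so irreducibility makes it all of
    [C]. *)
Lemma irreducible_cut_set_open (R : realFieldType) (X : pseudoMetricType R)
    (Y C : set X) : irreducible_cut_set Y C ->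
  exists U V, [/\ open U, open V, U `&` V = set0,
    Y `&` U !=set0 /\ Y `&` V !=set0 & C = Y `\` (U `|` V)].
Proof.
move=> [[CY /connectedPn[E [E0 EY sE]]] minC].
have [U [V [oU oV EU EV UV0]]] := separated_open_disjoint sE.
have EsubY b : E b `<=` Y.
  have : E false `|` E true `<=` Y by rewrite -EY => y [].
  by case: b => EE y Ey; apply: EE; [right|left].
have YU0 : Y `&` U !=set0.
  by have [y Ey] := E0 false; exists y; split; [exact: EsubY Ey|exact: EU].
have YV0 : Y `&` V !=set0.
  by have [y Ey] := E0 true; exists y; split; [exact: EsubY Ey|exact: EV].
exists U, V; split=> //; apply: contrapT => CE.
have DC : Y `\` (U `|` V) `<=` C.
  move=> y [Yy nUV]; apply: contrapT => nCy; apply: nUV.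
  have : (Y `\` C) y by [].
  by rewrite EY => -[/EU|/EV]; [left|right].
have cD : connected (Y `\` (Y `\` (U `|` V))).
  apply: minC.
    split=> // CD; apply: CE; exact/seteqP.
  by exists (~` (U `|` V)) => //; exact/open_closedC/openU.
have DE : Y `\` (Y `\` (U `|` V)) = Y `&` (U `|` V).
  by rewrite setDD.
rewrite DE in cD.
have := connected_open_cover cD oU oV (@subIsetr _ _ _).
rewrite UV0 setI0 => /(_ erefl).
have [u [Yu Uu]] := YU0; have [v [Yv Vv]] := YV0.
move=> /(_ _ v)-Uv; rewrite -[False]/(set0 v) -UV0; split=> //.
by apply: Uv => //; [exists u; split=> //; split=> //; left|split=> //; right].
Qed.

(** If an open [W] around a point of [C] missed the part of [Y] in [V], then [C] minus [W] would be
    a smaller relatively closed cut set, with [U] and [W] together on one side and [V] on the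
    other. *)
Lemma irreducible_cut_set_closure (X : topologicalType) (Y C U V : set X) :
  irreducible_cut_set Y C -> open U -> open V -> U `&` V = set0 ->
  Y `&` U !=set0 -> Y `&` V !=set0 -> C = Y `\` (U `|` V) ->
  C `<=` closure (Y `&` V).
Proof.
move=> [[CY _] minC] oU oV UV0 [u [Yu Uu]] [v [Yv Vv]] CE x Cx W0 /nbhs_interior W0x.
apply: contrapT => W0V.
pose W := W0^°.
have oW : open W by exact: open_interior.
have WV0 y : Y y -> W y -> V y -> False.
  by move=> Yy /interior_subset Wy Vy; apply: W0V; exists y.
have DE : Y `\` (C `\` W) = Y `&` ((U `|` W) `|` V).
  rewrite CE; apply/seteqP; split=> y [Yy].
    move=> nCW; split=> //; apply: contrapT => nUV; apply: nCW; split.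
      by split=> // -[?|?]; apply: nUV; [left; left|right].
    by move=> ?; apply: nUV; left; right.
  move=> UWV; split=> // -[[_ nUV] nW].
  by case: UWV => [[]|] // ?; apply: nUV; [left|right].
have : connected (Y `\` (C `\` W)).
  apply: minC.
    split; first by move=> y [].
    by move=> /(_ _ Cx)[_]; apply; exact: nbhs_singleton W0x.
  exists (~` (U `|` V `|` W)); first exact/open_closedC/openU/oW/openU.
  by rewrite CE setCU setIA.
rewrite DE => /connected_open_cover/(_ (openU oU oW) oV (@subIsetr _ _ _)).
have -> : Y `&` (U `|` W `|` V) `&` ((U `|` W) `&` V) = set0.
  rewrite -subset0 => y [[Yy _] [[Uy|Wy] Vy]]; last exact: WV0 Vy.
  by rewrite -UV0.
move=> /(_ erefl)/(_ _ v)[||Uv|Wv].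
- by exists u; split=> //; [split=> //; left; left|left].
- by split=> //; right.
- by rewrite -[False]/(set0 v) -UV0.
- exact: WV0 Vv.
Qed.

(** * Sup-norm estimates and bounded integer matrices *)

Lemma norm_mx_entry_le (R : realType) m n (A : 'M[R]_(m, n)) i j :
  `|A i j| <= `|A|.
Proof.
rewrite [leRHS]/Num.Def.normr /= mx_normrE.
exact: (@le_bigmax _ _ _ 0 (fun ij => `|A ij.1 ij.2|) (i, j)).
Qed.

Lemma norm_mulmx_le (R : realType) m n (A : 'M[R]_(m, n)) (v : 'cV[R]_n) (a : R) :
  0 <= a -> (forall i j, `|A i j| <= a) -> `|A *m v| <= n%:R * a * `|v|.
Proof.
move=> a0 Aa; rewrite [leLHS]/Num.Def.normr /= mx_normrE.
apply: bigmax_le => [|[i j] _]; first by rewrite !mulr_ge0.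
rewrite mxE (le_trans (ler_norm_sum _ _ _))//.
rewrite -[n in n%:R]card_ord -mulrA mulr_natl -sumr_const.
apply: ler_sum => k _; rewrite normrM ler_pM//.
exact: norm_mx_entry_le.
Qed.

Lemma mulmx_continuous (R : realType) m n (A : 'M[R]_(m, n)) :
  continuous (fun v : 'cV[R]_n => A *m v).
Proof.
apply: (@bounded_linear_continuous _ _ _ (mulmx A)).
apply/bounded_funP => r; exists (n%:R * `|A| * r) => v vr.
by rewrite (le_trans (norm_mulmx_le _ (normr_ge0 A) (norm_mx_entry_le A)))//
  ler_wpM2l// mulr_ge0.
Qed.

(** Entries shifted by [N] lie between 0 and [N + N], so finite functions parametrize these
    matrices. *)
Lemma finite_bounded_intmx m n (N : nat) :
  finite_set [set M : 'M[int]_(m, n) | forall i j, (`|M i j| <= N)%N].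
Proof.
pose f (g : {ffun 'I_m * 'I_n -> 'I_(N + N).+1}) : 'M[int]_(m, n) :=
  \matrix_(i, j) (Posz (g (i, j)) - Posz N).
apply: (@sub_finite_set _ _ (f @` setT)); last exact/finite_image/finite_finset.
move=> M MN; exists [ffun ij => inord (absz (M ij.1 ij.2 + Posz N))] => //.
apply/matrixP => i j; rewrite !mxE ffunE /=.
have := MN i j => MijN.
rewrite inordK; lia.
Qed.

(** * A covering criterion for perfect cut sets *)

(** The topological half of the argument, with the copies of the tile abstracted to [P]. For [i = j]
    the last clause excludes a piece reduced to [x]. *)
Lemma irreducible_cut_set_perfect (R : realFieldType) (X : pseudoMetricType R)
    (Y C : set X) :
  closed Y ->
  (forall (x : X) (W : set X), Y x -> nbhs x W ->
    exists (I : choiceType) (S : set I) (P : I -> set X),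
      [/\ finite_set S, Y = \bigcup_(i in S) P i,
        forall i, S i -> closed (P i),
        forall i, S i -> P i x -> connected (P i `\ x) /\ P i `<=` W &
        forall i j, S i -> S j -> P i `&` P j <> [set x]]) ->
  irreducible_cut_set Y C -> perfect_set C.
Proof.
move=> clY pieces irrC.
have [U [V [oU oV UV0 [YU0 YV0] CE]]] := irreducible_cut_set_open irrC.
have CV := irreducible_cut_set_closure irrC oU oV UV0 YU0 YV0 CE.
have CU : C `<=` closure (Y `&` U).
  by apply: (irreducible_cut_set_closure irrC oV oU) => //; rewrite 1?setIC// setUC.
apply/perfectP; split.
  by rewrite CE setDE; apply: closedI => //; exact/open_closedC/openU.
rewrite -subset0 => x [/set_mem Cx [W Wx WC]].
have [Yx nUVx] : (Y `\` (U `|` V)) x by rewrite -CE.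
have [I [S [P [finS YE clP PS Pij]]]] := pieces x W Yx Wx.
(* [F] is closed as a finite union, so points of [Y] close to [x] lie only in pieces through [x]. *)
pose F := \bigcup_(i in S `&` [set i | ~ P i x]) P i.
have Fx : nbhs x (~` F).
  apply: open_nbhs_nbhs; split; last by case=> i [].
  apply: closed_openC; apply: closed_bigcup; first exact: finite_setIl.
  by move=> i [/clP].
have side (A B : set X) : open A -> open B -> A `&` B = set0 ->
    A `|` B = U `|` V -> C `<=` closure (Y `&` A) ->
    exists2 i, S i & P i x /\ P i `\ x `<=` A.
  move=> oA oB AB0 ABE /(_ _ Cx _ Fx)[a [[Ya Aa] nFa]].
  have := Ya; rewrite YE => -[i Si Pia]; exists i => //.
  have Pix : P i x by apply: contrapT => nPix; apply: nFa; exists i.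
  have [cPi PiW] := PS _ Si Pix.
  split=> //; apply: (connected_open_cover cPi oA oB).
  (* A point of the piece outside [U] and [V] lies in [C] and in [W], hence is [x]. *)
  - move=> y [Piy yx]; rewrite ABE; apply: contrapT => nUVy; apply: yx.
    rewrite -[_ y]/([set x] y) -WC; split; first exact: PiW.
    by rewrite CE; split=> //; rewrite YE; exists i.
  - by rewrite AB0 setI0.
  - exists a; split=> //; split=> // ax; apply: nUVx; rewrite -ABE -ax.
    by left.
have [i Si [Pix PiU]] := side U V oU oV UV0 erefl CU.
have VU0 : V `&` U = set0 by rewrite setIC.
have [j Sj [Pjx PjV]] := side V U oV oU VU0 (setUC _ _) CV.
apply: (Pij i j Si Sj); apply/seteqP; split=> [y [Piy Pjy]|y ->//] /=.
apply: contrapT => yx; rewrite -[False]/(set0 y) -UV0.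
by split; [exact: PiU|exact: PjV].
Qed.

(** * Small affine copies of a tile *)

Lemma compact_closed_mx (R : realType) m n (K : set 'M[R]_(m, n)) :
  compact K -> closed K.
Proof. by apply: compact_closed; exact: (@norm_hausdorff R 'M[R]_(m, n)). Qed.

Section tile.
Variables (R : realType) (d : nat) (A : 'M[int]_d) (D : set 'cV[int]_d).
Variable (T : set 'cV[R]_d).
Hypothesis tileT : Zd_tile A D T.

Let AR : 'M[R]_d := map_mx intr A.
Let B := invmx AR.

Definition piece n (s : 'cV[int]_d) := [set B ^+ n *m (y + zvec R s) | y in T].

Let uA : AR \in unitmx.
Proof. exact/expanding_unitmx_real/tile_expanding/tileT. Qed.

Lemma zvecD (s t : 'cV[int]_d) : zvec R (s + t) = zvec R s + zvec R t.
Proof. exact: map_mxD. Qed.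

Lemma zvecB (s t : 'cV[int]_d) : zvec R (s - t) = zvec R s - zvec R t.
Proof. exact: map_mxB. Qed.

Lemma mulmx_zvec n s : AR ^+ n *m zvec R s = zvec R (A ^+ n *m s).
Proof. by rewrite /zvec map_mxM rmorphXn. Qed.

Lemma expmxVK n (v : 'cV[R]_d) : B ^+ n *m (AR ^+ n *m v) = v.
Proof.
elim: n v => [|n IH] v; first by rewrite !mul1mx.
by rewrite exprSr exprS -!mulmxA mulKmx.
Qed.

Lemma expmxKV n (v : 'cV[R]_d) : AR ^+ n *m (B ^+ n *m v) = v.
Proof.
elim: n v => [|n IH] v; first by rewrite !mul1mx.
by rewrite exprSr exprS -!mulmxA mulKVmx.
Qed.

Lemma pieceP n s x : piece n s x <-> T (AR ^+ n *m x - zvec R s).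
Proof.
split=> [[y Ty <-]|Tx]; first by rewrite expmxKV addrK.
by exists (AR ^+ n *m x - zvec R s) => //; rewrite subrK expmxVK.
Qed.

Lemma tile_norm_bounded : exists2 M, 0 <= M & forall x, T x -> `|x| <= M.
Proof.
have [M [_ MT]] := compact_bounded (tile_compact tileT).
exists (`|M| + 1); first by rewrite addr_ge0.
by move=> x Tx; apply: MT => //; rewrite (le_lt_trans (ler_norm M)) ?ltrDl.
Qed.

(** Iterating the tile equation gives [S = D + A D + ... + A^(n-1) D], starting from [{0}] at
    [n = 0]. *)
Lemma tile_expansion n : exists S : set 'cV[int]_d,
  [set AR ^+ n *m x | x in T] = \bigcup_(s in S) translate T s.
Proof.
elim: n => [|n [S IH]].
  exists [set 0]; rewrite bigcup_set1 /translate.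
  by apply: eq_imagel => x _; rewrite mul1mx /zvec map_mx0 addr0.
exists [set se.1 + A ^+ n *m se.2 | se in S `*` D].
have ARe x e : AR ^+ n *m (x + zvec R e) = AR ^+ n *m x + zvec R (A ^+ n *m e).
  by rewrite mulmxDr mulmx_zvec.
apply/seteqP; split.
  move=> _ [x Tx <-]; rewrite exprSr -mulmxA.
  have : [set AR *m x | x in T] (AR *m x) by exists x.
  rewrite (tile_equation tileT) => -[e De [y Ty <-]]; rewrite ARe.
  have : [set AR ^+ n *m x | x in T] (AR ^+ n *m y) by exists y.
  rewrite IH => -[s Ss [z Tz <-]].
  by exists (s + A ^+ n *m e); [exists (s, e)|exists z; rewrite // zvecD addrA].
move=> _ [_ [[s e] [/= Ss De] <-] [z Tz <-]].
rewrite zvecD addrA.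
have : (\bigcup_(s in S) translate T s) (z + zvec R s) by exists s => //; exists z.
rewrite -IH => -[y Ty <-]; rewrite -ARe.
have : (\bigcup_(e in D) translate T e) (y + zvec R e) by exists e => //; exists y.
rewrite -(tile_equation tileT) => -[x Tx <-].
by exists x => //; rewrite exprSr mulmxA.
Qed.

Lemma tile_pieces n : exists2 S : set 'cV[int]_d,
  finite_set S & T = \bigcup_(s in S) piece n s.
Proof.
have [S SE] := tile_expansion n; exists S; last first.
  apply/seteqP; split=> x.
    move=> Tx; have : [set AR ^+ n *m x | x in T] (AR ^+ n *m x) by exists x.
    by rewrite SE => -[s Ss [y Ty yE]]; exists s => //; apply/pieceP; rewrite -yE addrK.
  move=> [s Ss /pieceP Tx].
  have : (\bigcup_(s in S) translate T s) (AR ^+ n *m x).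
    by exists s => //; exists (AR ^+ n *m x - zvec R s); rewrite // subrK.
  by rewrite -SE => -[y Ty /(congr1 (mulmx (B ^+ n)))]; rewrite !expmxVK => <-.
(* The translates T + s, s in S, lie in the bounded set A^n T. *)
have [t Tt] := tile_nonempty tileT.
have [M M0 MT] := tile_norm_bounded.
(* [K] bounds the norm of [A^n x - t] for [x] in [T], and each [s] in [S] has this form. *)
pose K := d%:R * `|AR ^+ n| * M + M.
apply: sub_finite_set (finite_bounded_intmx d 1 (Num.truncn K).+1) => s Ss i j /=.
have : (\bigcup_(s in S) translate T s) (t + zvec R s) by exists s => //; exists t.
rewrite -SE => -[x Tx xE].
have sE : zvec R s = AR ^+ n *m x - t by rewrite xE addrC addKr.
have sK : `|zvec R s| <= K.
  rewrite sE (le_trans (ler_normB _ _))// lerD ?MT//.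
  rewrite (le_trans (norm_mulmx_le _ (normr_ge0 _) (norm_mx_entry_le (AR ^+ n))))//.
  by rewrite ler_wpM2l ?mulr_ge0 ?MT.
have : `|zvec R s i j| <= K.
  by apply: le_trans sK; exact: norm_mx_entry_le.
rewrite mxE -intr_norm -natr_absz => sijK.
by rewrite ltnW// -(ltr_nat R) (le_lt_trans sijK)// truncnS_gt.
Qed.

(** The translation cancels in differences, so one [n] serves all [s]. *)
Lemma piece_small (e : R) : 0 < e ->
  exists n, forall s x y, piece n s x -> piece n s y -> `|x - y| < e.
Proof.
move=> e0; have [M M0 MT] := tile_norm_bounded.
(* Chosen so that [d * 2M * a < e]; the summand 1 keeps the denominator positive. *)
pose a := e / (d%:R * (M + M) + 1).
have den0 : 0 < d%:R * (M + M) + 1 by rewrite ltr_wpDl// mulr_ge0// addr_ge0.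
have a0 : 0 < a by rewrite divr_gt0.
have : \forall n \near \oo, forall ij : 'I_d * 'I_d, `|(B ^+ n) ij.1 ij.2| <= a.
  apply: filter_forall => -[i j].
  by have /cvgr0Pnorm_le/(_ a a0) := expanding_cvg0 (tile_expanding tileT) i j.
move=> /filter_ex[n Ba]; exists n => s _ _ [x Tx <-] [y Ty <-].
rewrite -mulmxBr opprD addrACA subrr addr0.
rewrite (le_lt_trans (norm_mulmx_le _ (ltW a0) (fun i j => Ba (i, j))))//.
rewrite (@le_lt_trans _ _ (d%:R * (M + M) * a))//.
  rewrite mulrAC ler_wpM2r ?(ltW a0)// ler_wpM2l// (le_trans (ler_normB _ _))//.
  by rewrite lerD ?MT.
by rewrite /a mulrA ltr_pdivrMr// mulrC ltr_pM2l// ltrDl.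
Qed.

Lemma piece_map_continuous n s :
  continuous (fun y : 'cV[R]_d => B ^+ n *m (y + zvec R s)).
Proof.
move=> y; have := @continuous_comp _ _ _ (fun y : 'cV[R]_d => y + zvec R s)
  (fun v : 'cV[R]_d => B ^+ n *m v) y.
apply; last exact: mulmx_continuous.
exact: (@continuousD _ _ _ id (cst (zvec R s)) y (@cvg_id _ _) (@cst_continuous _ _ _ y)).
Qed.

Lemma piece_compact n s : compact (piece n s).
Proof.
rewrite /piece; apply: continuous_compact; last exact: tile_compact tileT.
exact/continuous_subspaceT/piece_map_continuous.
Qed.

(** By injectivity of the affine map, the piece without [x] is the continuous image of [T] without
    the preimage of [x]. *)
Lemma piece_setD1_connected n s x : (forall y, T y -> connected (T `\ y)) ->
  piece n s x -> connected (piece n s `\ x).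
Proof.
move=> cT /pieceP Tx.
have -> : piece n s `\ x = [set B ^+ n *m (y + zvec R s) |
    y in T `\ (AR ^+ n *m x - zvec R s)].
  apply/seteqP; split=> z.
    move=> [/pieceP Tz zx]; exists (AR ^+ n *m z - zvec R s).
      split=> // /addIr /(congr1 (mulmx (B ^+ n))); rewrite !expmxVK => zxE.
      exact: zx.
    by rewrite subrK expmxVK.
  move=> [y [Ty yx] <-]; split; first by exists y.
  by move=> yE; apply: yx; rewrite /= -yE expmxKV addrK.
apply: connected_continuous_connected; first exact: cT.
exact/continuous_subspaceT/piece_map_continuous.
Qed.

(** The map [y |-> A^-n (y + s)] carries the intersection of [T] with [T + (t - s)] onto that of the
    two pieces. *)
Lemma piece_setI1 n s t x : piece n s `&` piece n t = [set x] ->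
  T `&` translate T (t - s) = [set AR ^+ n *m x - zvec R s].
Proof.
move=> st.
have [/pieceP Tsx /pieceP Ttx] : (piece n s `&` piece n t) x by rewrite st.
apply/seteqP; split=> [y [Ty [z Tz zy]]|_ ->].
  have : (piece n s `&` piece n t) (B ^+ n *m (y + zvec R s)).
    split; first by exists y.
    by exists z => //; rewrite -zy zvecB -addrA subrK.
  by rewrite st => <-; rewrite expmxKV addrK.
split=> //; exists (AR ^+ n *m x - zvec R t) => //.
by rewrite zvecB addrA subrK.
Qed.

End tile.

Theorem corollary3p2 (R : realType) (d : nat) (A : 'M[int]_d)
    (D : set 'cV[int]_d) (T : set 'cV[R]_d)
    (tileT : Zd_tile A D T)
    (connT : connected T)
    (capT : forall s : 'cV[int]_d, ~ (T `&` translate T s #= `I_1)%card) :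
  (exists x : 'cV[R]_d, cut_point T x) \/
  (forall X : set 'cV[R]_d, irreducible_cut_set T X -> perfect_set X).
Proof.
have [|ncut] := pselect (exists x, cut_point T x); [by left|right=> X].
have cT y : T y -> connected (T `\ y).
  move=> Ty; apply: contrapT => nc; apply: ncut; exists y; split=> //.
  by split=> // _ ->.
apply: irreducible_cut_set_perfect.
  exact: compact_closed_mx (tile_compact tileT).
move=> x W Tx /nbhs_ballP[e e0 eW].
have [n nsmall] := piece_small tileT e0.
have [S finS TE] := tile_pieces tileT n.
exists _, S, (piece A T n); split=> //; last first.
(* Equal indices are covered too, through [capT] at 0. *)
- by move=> s t _ _ /(piece_setI1 tileT) st; apply: (capT (t - s)); rewrite st card_set1.
- move=> s _ sx; split; first exact: (piece_setD1_connected tileT cT sx).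
  by move=> y sy; apply: eW; rewrite -ball_normE; exact: nsmall sx sy.
- by move=> s _; exact: compact_closed_mx (@piece_compact _ _ _ _ _ tileT n s).
Qed.
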